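(* Let $N$ source domains and one target domain with class label $Y\in\{1,\dots,C\}$, latent representation $\mathbf{z}\in\mathcal{Z}\subset\mathbb{R}^n$, polar coordinates $(r,\boldsymbol{\phi})=g(\mathbf{z})$ and $L_2$-normalization $\mathbf{z}^*=\mathbf{z}/\sqrt{z_1^2+\dots+z_n^2}$ be given. Assume: (i) (angular invariance) for $d=1,\dots,N$, $p(\boldsymbol{\phi}\mid Y,D=d)=p^t(\boldsymbol{\phi}\mid Y)$; (ii) (von Mises–Fisher mixture) the normalized latent representation $\mathbf{Z}^*$ follows a von Mises–Fisher mixture distribution $$p(\mathbf{z}^* )=\sum_{y=1}^C P(Y=y)\,p(\mathbf{z}^*\mid Y=y),\qquad p(\mathbf{z}^*\mid Y=y)=\frac{\kappa^{n/2-1}}{(2\pi)^{n/2}I_{n/2-1}(\kappa)}\exp(\kappa\,\mathbf{w}_y^{\top}\mathbf{z}^* ),$$ such that the posterior satisfies $p(y\mid\mathbf{z},D)=p(y\mid\mathbf{z}^* )$. Then, for a source domain index $d\in\{1,\dots,N\}$, $$p^t(y\mid\mathbf{z})=\frac{p(\mathbf{z}^*\mid Y=y)\,w(r\mid\boldsymbol{\phi},d,y)\,P(Y=y)}{\sum_{c=1}^C p(\mathbf{z}^*\mid Y=c)\,w(r\mid\boldsymbol{\phi},d,c)\,P(Y=c)}=\frac{\exp(\kappa\mathbf{w}_y^{\top}\mathbf{z}^* )\,w(r\mid\boldsymbol{\phi},d,y)\,P(Y=y)}{\sum_{c=1}^C\exp(\kappa\mathbf{w}_c^{\top}\mathbf{z}^*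 )\,w(r\mid\boldsymbol{\phi},d,c)\,P(Y=c)}.$$
   Context: Setting: there are $N$ source distributions and one target distribution (superscript $t$) on an input-label space $\mathcal{X}\times\mathcal{Y}$; the source distributions are pairwise different and each differs from the target distribution. $D$ is a random variable indexing the source domains: $D=d$ denotes the $d$-th source domain. The marginals of all domains on $\mathcal{X}$ are continuous, and a feature extraction map $\pi:\mathcal{X}\to\mathcal{Z}\subset\mathbb{R}^n$ is fixed such that the push-forwards under $\pi$ have probability density functions on $\mathcal{Z}$; $\mathbf{Z}=\pi(\mathbf{X})$ is the latent representation and $\mathbf{Z}^*$ its $L_2$-normalization. $p(\mathbf{z}\mid D=d,Y)$ and $p^t(\mathbf{z}\mid Y)$ are the class-conditional densities of the $d$-th source domain and of the target domain. $g(z_1,\dots,z_n)=(r,\boldsymbol{\phi})$, $\boldsymbol{\phi}=(\phi_1,\dots,\phi_{n-1})$, is the (bijective) polar reparametrization of $\mathbf{z}$, with $r=\sqrt{z_1^2+\dots+z_n^2}$. $p(\boldsymbol{\phi}\mid\cdot)$ denotes the conditional density of the angular coordinates and $p(r\mid\boldsymbol{\phi},\cdot)$ the conditional density of the norm given the angles (superscript $t$ for the target). The ratio $w$ is $$w(r\mid\boldsymbol{\phi},d,y)=\frac{p^t(r\mid\boldsymbol{\phi},Y=y)}{p(r\mid\boldsymbol{\phi},D=d,Y=y)}.$$ $p^t(y\mid\mathbf{z})$ is the posterior of class $y$ given $\mathbf{z}$ in the target domain, $p(y\mid\mathbf{z},D)$ the posterior of class $y$ given $\mathbf{z}$ in a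 source domain, and $p(y\mid\mathbf{z}^* )$ the posterior of class $y$ given $\mathbf{z}^*$. $P(Y=y)$ is the class probability, the same symbol (written without a domain index) that appears as the weight of the $y$-th component of the mixture. $\kappa$ (common to all classes) and $\mathbf{w}_1,\dots,\mathbf{w}_C$ are the concentration and mean direction parameters of the von Mises–Fisher components, and $I_\nu$ is the modified Bessel function of the first kind of order $\nu$. *)

(* Defs.v *)
From HB Require Import structures.
From mathcomp Require Import all_boot all_order all_algebra.
From mathcomp Require Import all_classical all_reals all_analysis.
From mathcomp Require Import measurable_realfun.

Set Implicit Arguments.
Unset Strict Implicit.
Unset Printing Implicit Defensive.

Import Order.TTheory GRing.Theory Num.Theory.
Import numFieldNormedType.Exports.

Local Open Scope classical_set_scope.
Local Open Scope ring_scope.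

Section lebesgue_tuple.
Variable R : realType.

Definition cons_pair n (xt : R * n.-tuple R) : n.+1.-tuple R :=
  [tuple of xt.1 :: xt.2].

Lemma measurable_cons_pair n : measurable_fun setT (@cons_pair n).
Proof. exact: measurable_cons. Qed.

Section step.
Variables (n : nat) (m : {sigma_finite_measure set (n.-tuple R) -> \bar R}).

Definition cons_measure : set (n.+1.-tuple R) -> \bar R :=
  pushforward (lebesgue_measure \x m)%E (@cons_pair n).

Let cons_measure0 : cons_measure set0 = 0%E.
Proof. by rewrite /cons_measure /pushforward preimage_set0 measure0. Qed.

Let cons_measure_ge0 A : (0 <= cons_measure A)%E.
Proof. by rewrite /cons_measure /pushforward; exact: measure_ge0. Qed.

Let cons_measure_sigma_additive : semi_sigma_additive cons_measure.
Proof.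
have mc A : measurable A -> measurable (@cons_pair n @^-1` A).
  by move=> mA; rewrite -[X in measurable X]setTI; exact: measurable_cons_pair.
move=> F mF tF mUF; rewrite /cons_measure /pushforward preimage_bigcup.
apply: measure_semi_sigma_additive => [i||]; first exact: mc.
  apply/trivIsetP => i j _ _ ij; rewrite -preimage_setI.
  by move/trivIsetP : tF => /(_ _ _ _ _ ij) ->//; rewrite preimage_set0.
by rewrite -preimage_bigcup; exact: mc.
Qed.

HB.instance Definition _ := isMeasure.Build _ _ _ cons_measure
  cons_measure0 cons_measure_ge0 cons_measure_sigma_additive.

Let cons_measure_sigma_finite : sigma_finite setT cons_measure.
Proof.
have /sigma_finiteP[F [TF ndF Foo]] := sigma_finiteT (@lebesgue_measure R).
have /sigma_finiteP[G [TG ndG Goo]] := sigma_finiteT m.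
pose uncons (t : n.+1.-tuple R) : measurableTypeR R * n.-tuple R :=
  (thead t, [tuple of behead t]).
have munc : measurable_fun [set: n.+1.-tuple R] uncons.
  by apply/measurable_fun_pair; [exact: measurable_tnth|exact: measurable_behead].
exists (fun i => uncons @^-1` (F i `*` G i)).
  apply/esym; rewrite -subTset => t _.
  have [i _ Fi] : (\bigcup_k F k) (thead t) by rewrite -TF.
  have [j _ Gj] : (\bigcup_k G k) [tuple of behead t] by rewrite -TG.
  exists (maxn i j) => //; split => /=.
    by move: Fi; exact/subsetPset/ndF/leq_maxl.
  by move: Gj; exact/subsetPset/ndG/leq_maxr.
move=> i; have [mF Fi] := Foo i; have [mG Gi] := Goo i; split.
  by rewrite -[X in measurable X]setTI; apply: munc => //; exact: measurableX.
rewrite /cons_measure /pushforward -comp_preimage.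
rewrite (_ : uncons \o _ = id) ?preimage_id; last first.
  by apply/funext => -[x t]; congr pair; exact: val_inj.
by rewrite product_measure1E// lte_mul_pinfty// ge0_fin_numE.
Qed.

HB.instance Definition _ := Measure_isSigmaFinite.Build _ _ _ cons_measure
  cons_measure_sigma_finite.

End step.

(* Lebesgue measure on R^n, as the n-fold product measure. *)
Fixpoint lebesgue_tuple n : {sigma_finite_measure set (n.-tuple R) -> \bar R} :=
  match n with
  | 0 => \d_ [tuple]
  | n'.+1 => cons_measure (lebesgue_tuple n')
  end.

End lebesgue_tuple.

Section euclidean.
Variables (R : realType) (n : nat).
Implicit Types u v z : n.-tuple R.

Definition dotp u v : R := \sum_(i < n) tnth u i * tnth v i.

Definition l2norm z : R := Num.sqrt (\sum_(i < n) tnth z i ^+ 2).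

(* The value at z = 0 is 0. *)
Definition l2normalize z : n.-tuple R :=
  [tuple tnth z i / l2norm z | i < n].

Lemma measurable_l2norm : measurable_fun setT l2norm.
Proof.
apply: measurableT_comp.
  exact: (continuous_measurable_fun (@sqrt_continuous R)).
apply: measurable_sum => i; apply: measurable_funX; exact: measurable_tnth.
Qed.

Lemma measurable_l2normalize : measurable_fun setT l2normalize.
Proof.
apply/measurable_fun_tnthP => i.
rewrite (_ : _ \o _ = fun z => tnth z i * (l2norm z `^ (-1))); last first.
  by apply/funext => z /=; rewrite tnth_mktuple powR_inv1// sqrtr_ge0.
apply: measurable_funM; first exact: measurable_tnth.
exact: (measurableT_comp (measurable_powR (-1)) measurable_l2norm).
Qed.

(* Surface (Hausdorff) measure of the unit sphere, normalized so that its total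
   mass is the area of the sphere: sigma(A) = n * vol {r u | u in A, 0 < r <= 1}.
   It is a measure on R^n carried by the sphere. *)
Definition sphere_measure (A : set (n.-tuple R)) : \bar R :=
  (n%:R%:E * lebesgue_tuple R n
     ([set z | (0 < l2norm z <= 1)%R] `&` l2normalize @^-1` A))%E.

Let msphere_ball : measurable [set z : n.-tuple R | 0 < l2norm z <= 1].
Proof.
rewrite (_ : mkset _ = l2norm @^-1` `]0, 1]); last first.
  by apply/seteqP; split => z /=; rewrite in_itv.
by rewrite -[X in measurable X]setTI; exact: measurable_l2norm.
Qed.

Let sphere_measure0 : sphere_measure set0 = 0%E.
Proof. by rewrite /sphere_measure preimage_set0 setI0 measure0 mule0. Qed.

Let sphere_measure_ge0 A : (0 <= sphere_measure A)%E.
Proof. by rewrite /sphere_measure mule_ge0. Qed.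

Let sphere_measure_sigma_additive : semi_sigma_additive sphere_measure.
Proof.
have mN A : measurable A -> measurable (l2normalize @^-1` A).
  by move=> mA; rewrite -[X in measurable X]setTI; exact: measurable_l2normalize.
pose mu := mscale (NngNum (ler0n R n))
  (mrestr (lebesgue_tuple R n) msphere_ball).
have sE A : sphere_measure A = mu (l2normalize @^-1` A).
  by rewrite /sphere_measure setIC.
move=> F mF tF mUF; under eq_fun do under eq_bigr do rewrite sE.
rewrite sE preimage_bigcup.
apply: (@measure_semi_sigma_additive _ _ _ mu) => [i||]; first exact: mN.
  apply/trivIsetP => i j _ _ ij; rewrite -preimage_setI.
  by move/trivIsetP : tF => /(_ _ _ _ _ ij) ->//; rewrite preimage_set0.
by rewrite -preimage_bigcup; exact: mN.
Qed.

HB.instance Definition _ := isMeasure.Build _ _ _ sphere_measure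
  sphere_measure0 sphere_measure_ge0 sphere_measure_sigma_additive.

End euclidean.

Section polar_coordinates.
Variables (R : realType) (n : nat).
Implicit Types z : n.-tuple R.

Definition tail_norm z (k : nat) : R :=
  Num.sqrt (\sum_(i < n | (k <= i)%N) tnth z i ^+ 2).

(* Hyperspherical angles: with 0-based indices,
     z_k = r sin(phi_0) ... sin(phi_(k-1)) cos(phi_k)   for k < n - 1,
     z_(n-1) = r sin(phi_0) ... sin(phi_(n-2)),
   phi_0, ..., phi_(n-3) in [0, pi] and phi_(n-2) in [0, 2 pi). An angle that z
   leaves undetermined (zero tail) is set to acos 0 = pi / 2. *)
Definition polar_angle z (k : nat) : R :=
  let a := acos (nth 0 z k / tail_norm z k) in
  if (k.+2 == n) && (nth 0 z k.+1 < 0) then 2 * pi - a else a.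

Definition polar_angles z : n.-1.-tuple R := [tuple polar_angle z k | k < n.-1].

Definition polar_coords z : R * n.-1.-tuple R := (l2norm z, polar_angles z).

End polar_coordinates.

Section von_mises_fisher.
Variable R : realType.

Definition gamma_fun (s : R) : R :=
  \int[lebesgue_measure]_(t in `]0, +oo[) (t `^ (s - 1) * expR (- t)).

(* Modified Bessel function of the first kind, for 0 < x and -1 < nu. *)
Definition besselI (nu x : R) : R :=
  limn (series (fun m : nat =>
    (x / 2) `^ (2 * m%:R + nu) / (m`!%:R * gamma_fun (m%:R + nu + 1)))).

Definition vmf_density n (kappa : R) (w s : n.-tuple R) : R :=
  kappa `^ (n%:R / 2 - 1)
    / ((2 * pi) `^ (n%:R / 2) * besselI (n%:R / 2 - 1) kappa)
  * expR (kappa * dotp w s).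

End von_mises_fisher.

Section conditioning.
Context d (T : measurableType d) (R : realType) (P : probability T R).

Definition cprob (E A : set T) : R := fine (P (A `&` E)) / fine (P E).

Definition class_prob C (Y : T -> 'I_C) (y : 'I_C) : R :=
  fine (P (Y @^-1` [set y])).

(* Joint law of (X, Y) given E, on the rectangles A x {y} with A measurable;
   as Y takes finitely many values they determine the law. *)
Definition joint_law dX (TX : measurableType dX) C (X : T -> TX) (Y : T -> 'I_C)
    (E : set T) (A : set TX) (y : 'I_C) : R :=
  cprob E (X @^-1` A `&` Y @^-1` [set y]).

Definition is_density dV (TV : measurableType dV) (E : set T) (V : T -> TV)
    (mu : set TV -> \bar R) (f : TV -> R) : Prop :=
  [/\ measurable_fun setT f, forall v, 0 <= f v &
      forall B, measurable B ->
        (cprob E (V @^-1` B))%:E = (\int[mu]_(v in B) (f v)%:E)%E].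

(* k u v is a version of the conditional density of U given V = v (and given the
   event E), where fV is the density of V given E: p(u, v) = p(u | v) p(v). *)
Definition is_cond_density dU dV (TU : measurableType dU)
    (TV : measurableType dV) (E : set T) (U : T -> TU) (V : T -> TV)
    (mu : set TU -> \bar R) (nu : set TV -> \bar R)
    (fV : TV -> R) (k : TU -> TV -> R) : Prop :=
  [/\ measurable_fun setT (fun uv : TU * TV => k uv.1 uv.2),
      forall u v, 0 <= k u v &
      is_density E (fun t => (U t, V t)) (mu \x nu)%E
        (fun uv => k uv.1 uv.2 * fV uv.2)].

(* eta y is a version of the conditional probability of Y = y given V, on the
   probability space conditioned on E. *)
Definition is_posterior dV (TV : measurableType dV) C (E : set T)
    (V : T -> TV) (Y : T -> 'I_C) (eta : 'I_C -> TV -> R) : Prop :=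
  forall y, [/\ measurable_fun setT (eta y), forall v, 0 <= eta y v <= 1 &
    forall B, measurable B ->
      P (E `&` V @^-1` B `&` Y @^-1` [set y]) =
        (\int[P]_(t in E `&` V @^-1` B) (eta y (V t))%:E)%E].

End conditioning.

(* Meaningful only where ps r phi != 0; the library convention x / 0 = 0 applies
   elsewhere. *)
Definition norm_ratio (R : realType) U (pt ps : R -> U -> R) (r : R) (phi : U)
    : R :=
  pt r phi / ps r phi.

(* Main.v *)
(* Work in the polar coordinates u = (r, phi) of z; since z is recovered from u
   by a measurable map, conditioning on Z and on u is the same. For an event
   E with class densities f_c, Bayes' rule reads
     eta_y * (sum_c p_c f_c) = p_y f_y   almost everywhere,
   for any version eta of the posterior. It is used three times: for Z* and the
   von Mises-Fisher densities, which identifies p(y | z* ); for the source d,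
   whose posterior is p(y | z* ) by assumption, which gives
   p_y f_y = p(y | z* ) q with q the mixture density of the source; and for the
   target, whose class densities are w(r | phi, d, y) f_y by angular invariance.
   The common factor q / p(z* ) then cancels. *)
Require Import Defs.
From HB Require Import structures.
From mathcomp Require Import all_boot all_order all_algebra.
From mathcomp Require Import all_classical all_reals all_analysis.
From mathcomp Require Import measurable_realfun.
From mathcomp Require Import ring lra.

Set Implicit Arguments.
Unset Strict Implicit.
Unset Printing Implicit Defensive.

Import Order.TTheory GRing.Theory Num.Theory.
Import numFieldNormedType.Exports.
Local Open Scope classical_set_scope.
Local Open Scope ring_scope.

(** * Integration against a law that has a density *)

Section integral_density.
Local Open Scope ereal_scope.
Context d1 d2 (S : measurableType d1) (T : measurableType d2) (R : realType).
Variables (nu : {measure set S -> \bar R}) (mu : {measure set T -> \bar R}).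
Variables (A : set S) (U : S -> T) (q : T -> R).
Hypotheses (mA : measurable A) (mU : measurable_fun setT U).
Hypotheses (mq : measurable_fun setT q) (q0 : forall v, (0 <= q v)%R).
Hypothesis qE : forall B, measurable B ->
  nu (A `&` U @^-1` B) = \int[mu]_(v in B) (q v)%:E.

Import HBNNSimple.

Let measurable_setI_preimage B : measurable B -> measurable (A `&` U @^-1` B).
Proof.
move=> mB; apply: measurableI => //; rewrite -[X in measurable X]setTI.
exact: mU.
Qed.

(** Both sides split over the finitely many level sets of [h]; on each of them the claim is [qE] for
    the intersection of [B] with that level set. *)
Let integral_density_nnsfun (h : {nnsfun T >-> R}) B : measurable B ->
  \int[nu]_(s in A `&` U @^-1` B) (h (U s))%:E =
  \int[mu]_(v in B) (h v * q v)%:E.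
Proof.
move=> mB; have mAB := measurable_setI_preimage mB.
have mhU r : measurable (U @^-1` (h @^-1` [set r])).
  by rewrite -[X in measurable X]setTI; exact: mU.
transitivity (\sum_(r \in range h) \int[nu]_(s in A `&` U @^-1` B)
    (r * \1_(U @^-1` (h @^-1` [set r])) s)%:E).
  rewrite -ge0_integral_fsum//.
  - by apply: eq_integral => s _; rewrite fimfunE -fsumEFin.
  - move=> r; apply: measurable_funTS; apply/measurable_EFinP.
    exact: measurable_funM.
  - by move=> r s _; exact: (nnfun_muleindic_ge0 _ _ (U s)).
transitivity (\sum_(r \in range h) \int[mu]_(v in B)
    ((r * \1_(h @^-1` [set r]) v)%:E * (q v)%:E)); last first.
  rewrite -ge0_integral_fsum//.
  - apply: eq_integral => v _; rewrite EFinM [in RHS]fimfunE -fsumEFin//.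
    by rewrite ge0_mule_fsuml// => r; exact: nnfun_muleindic_ge0.
  - move=> r; apply: emeasurable_funM; apply: measurable_funTS.
      by apply/measurable_EFinP; exact: measurable_funM.
    exact/measurable_EFinP.
  - by move=> r v _; apply: mule_ge0; [exact: nnfun_muleindic_ge0|rewrite lee_fin].
apply: eq_fsbigr => r /[!inE] -[t _ htr].
have r0 : (0 <= r)%R by rewrite -htr.
rewrite (@integralZl_indic _ _ _ _ _ _
  (fun r => U @^-1` (h @^-1` [set r])))//; last by rewrite ltNge r0.
under [RHS]eq_integral do rewrite EFinM -muleA.
rewrite ge0_integralZl//; last 2 first.
- by apply: emeasurable_funM; apply: measurable_funTS; exact/measurable_EFinP.
- by move=> v _; rewrite mule_ge0 ?lee_fin.
congr (_ * _); rewrite integral_indic// [X in nu X]setIC -setIA -preimage_setI qE//.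
rewrite integral_mkcondr; apply: eq_integral => v _.
by rewrite epatch_indic muleC.
Qed.

(** Simple functions increasing to [f] reduce this to the previous case, by monotone convergence on
    both sides. *)
Lemma integral_density (f : T -> R) B : measurable_fun setT f ->
  (forall v, (0 <= f v)%R) -> measurable B ->
  \int[nu]_(s in A `&` U @^-1` B) (f (U s))%:E =
  \int[mu]_(v in B) (f v * q v)%:E.
Proof.
move=> mf f0 mB; have mAB := measurable_setI_preimage mB.
have mEf : measurable_fun setT (EFin \o f) by exact/measurable_EFinP.
pose h := nnsfun_approx measurableT mEf.
have hf v : (h n v)%:E @[n --> \oo] --> (f v)%:E.
  by apply: cvg_nnsfun_approx => //= x _; rewrite lee_fin.
have hnd v : nondecreasing_seq (fun n => (h n v)%:E).
  by move=> a b ab; rewrite lee_fin; exact/lefP/nd_nnsfun_approx.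
transitivity (limn (fun n => \int[nu]_(s in A `&` U @^-1` B) (h n (U s))%:E)).
  rewrite -monotone_convergence//.
  - by apply: eq_integral => s _; apply/esym/cvg_lim.
  - move=> n; apply: measurable_funTS; apply/measurable_EFinP.
    exact: measurableT_comp.
  - by move=> n s _; rewrite lee_fin.
under eq_fun do rewrite integral_density_nnsfun//.
rewrite -monotone_convergence//.
- apply: eq_integral => v _; apply/cvg_lim => //; under eq_fun do rewrite EFinM.
  by rewrite EFinM; apply: cvgeZr.
- move=> n; apply: measurable_funTS; apply/measurable_EFinP.
  exact: measurable_funM.
- by move=> n v _; rewrite lee_fin mulr_ge0.
- by move=> v _ a b ab; rewrite lee_fin ler_wpM2r// -lee_fin; exact: hnd.
Qed.

End integral_density.

(** * Conditional probabilities and densities *)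

Lemma measurable_preimageT d1 d2 (S : measurableType d1) (T : measurableType d2)
    (U : S -> T) B :
  measurable_fun setT U -> measurable B -> measurable (U @^-1` B).
Proof. by move=> mU mB; rewrite -[X in measurable X]setTI; exact: mU. Qed.

Section cprob_density.
Context d1 d2 (S : measurableType d1) (T : measurableType d2) (R : realType).
Variables (P : probability S R) (mu : {measure set T -> \bar R}).
Variables (E : set S) (U : S -> T).
Hypotheses (mE : measurable E) (mU : measurable_fun setT U).

(** If [P E] is 0 the quotient in [cprob] is 0 by convention, and the left side vanishes by
    monotonicity. *)
Lemma measureI_cprob (A : set S) : measurable A ->
  P (E `&` A) = (fine (P E) * cprob P E A)%:E.
Proof.
move=> mA; rewrite /cprob setIC.
have [PE0|PE0] := eqVneq (fine (P E)) 0; last first.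
  by rewrite mulrCA divff// mulr1 fineK// fin_num_measure//; exact: measurableI.
have {}PE0 : P E = 0%E by rewrite -[LHS]fineK ?PE0// fin_num_measure.
have : (P (A `&` E) <= P E)%E by rewrite le_measure// inE//; exact: measurableI.
by rewrite PE0/= mul0r measure_le0 => /eqP.
Qed.

Lemma cprob_ge0 (A : set S) : 0 <= cprob P E A.
Proof. by rewrite /cprob divr_ge0// fine_ge0. Qed.

Lemma measureI_density (f : T -> R) B : is_density P E U mu f ->
  measurable B ->
  P (E `&` U @^-1` B) = (\int[mu]_(v in B) (fine (P E) * f v)%:E)%E.
Proof.
move=> [mf f0 fE] mB; rewrite measureI_cprob; last exact: measurable_preimageT.
under eq_integral do rewrite EFinM.
rewrite ge0_integralZl ?lee_fin ?fine_ge0//.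
- by rewrite EFinM fE.
- by apply: measurable_funTS; exact/measurable_EFinP.
- by move=> v _; rewrite lee_fin.
Qed.

End cprob_density.

(** * Bayes' rule for a finite mixture of classes *)

Section class_mixture.
Context d1 d2 (S : measurableType d1) (T : measurableType d2) (R : realType).
Variables (P : probability S R) (mu : {measure set T -> \bar R}) (C : nat).
Variables (E : set S) (Y : S -> 'I_C) (U : S -> T).
Hypotheses (mE : measurable E) (mY : forall y, measurable (Y @^-1` [set y])).
Hypothesis mU : measurable_fun setT U.
Variables (p : 'I_C -> R) (f : 'I_C -> T -> R).
Hypothesis pE : forall y, cprob P E (Y @^-1` [set y]) = p y.
Hypothesis fE : forall y, is_density P (E `&` Y @^-1` [set y]) U mu (f y).

Definition mixture v := \sum_(c < C) p c * f c v.

Let p_ge0 y : 0 <= p y. Proof. by rewrite -pE cprob_ge0. Qed.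

Let mf y : measurable_fun setT (f y). Proof. by case: (fE y). Qed.

Let f_ge0 y v : 0 <= f y v. Proof. by case: (fE y). Qed.

Lemma mixture_ge0 v : 0 <= mixture v.
Proof. by apply: sumr_ge0 => c _; rewrite mulr_ge0. Qed.

Lemma measurable_mixture : measurable_fun setT mixture.
Proof. by apply: measurable_sum => c; exact: measurable_funM. Qed.

Let measure_class B y : measurable B ->
  P (E `&` U @^-1` B `&` Y @^-1` [set y]) =
    (\int[mu]_(v in B) (fine (P E) * (p y * f y v))%:E)%E.
Proof.
move=> mB; rewrite -setIA (setIC (U @^-1` B)) setIA.
rewrite (measureI_density _ _ (fE y))//; last exact: measurableI.
by rewrite measureI_cprob// pE/=; apply: eq_integral => v _; rewrite mulrA.
Qed.

(** Total probability: the events of the classes partition the space, and the class densities add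
    up. *)
Lemma measure_mixture B : measurable B ->
  P (E `&` U @^-1` B) = (\int[mu]_(v in B) (fine (P E) * mixture v)%:E)%E.
Proof.
move=> mB; have mUB := measurable_preimageT mU mB.
transitivity (\sum_(y < C) P (E `&` U @^-1` B `&` Y @^-1` [set y])%classic)%E.
  rewrite -measure_bigsetU_ord//.
  - congr (P _); rewrite -bigcup_seq; apply/seteqP; split => s.
      by move=> EUs; exists (Y s) => //=; exact: mem_index_enum.
    by move=> [y _ []].
  - by move=> y; apply: measurableI => //; exact: measurableI.
  - apply/trivIsetP => y y' _ _ yy'; rewrite setIACA setIid -subset0.
    by move=> s [_ [/= -> /eqP]]; rewrite (negbTE yy').
under eq_bigr do rewrite measure_class//.
rewrite -ge0_integral_sum//.
- by apply: eq_integral => v _; rewrite sumEFin -mulr_sumr.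
- move=> y; apply: measurable_funTS; apply/measurable_EFinP.
  by do 2 apply: measurable_funM => //.
- by move=> y v _; rewrite lee_fin !mulr_ge0// fine_ge0.
Qed.

Lemma measure_mixture_eq0 : P (E `&` U @^-1` [set v | mixture v = 0]) = 0%E.
Proof.
rewrite measure_mixture; last first.
  have -> : [set v | mixture v = 0] = mixture @^-1` [set 0] by [].
  by rewrite -[X in measurable X]setTI; exact: measurable_mixture.
by apply: integral0_eq => v /= ->; rewrite mulr0.
Qed.

Lemma measure_mixture_null B : measurable B -> mu B = 0%E ->
  P (E `&` U @^-1` B) = 0%E.
Proof.
move=> mB B0; rewrite measure_mixture// null_set_integral//.
apply: measurable_funTS; apply/measurable_EFinP.
by apply: measurable_funM => //; exact: measurable_mixture.
Qed.

(** Over every measurable [B], both sides times [P E] integrate to the probability that [E] and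
    class [y] occur with [U] in [B]; functions with equal integrals agree almost everywhere. *)
Lemma bayes (eta : 'I_C -> T -> R) (y : 'I_C) : P E != 0%E ->
  is_posterior P E U Y eta ->
  {ae mu, forall v, eta y v * mixture v = p y * f y v}.
Proof.
move=> PE0 /(_ y)[meta eta01 etaE].
have eta0 v : 0 <= eta y v by case/andP: (eta01 v).
have e0 : fine (P E) != 0.
  by apply: contra PE0 => /eqP e0; rewrite -[P E]fineK ?e0// fin_num_measure.
have mq : measurable_fun setT (fun v => fine (P E) * mixture v).
  by apply: measurable_funM => //; exact: measurable_mixture.
have q0 v : 0 <= fine (P E) * mixture v.
  by rewrite mulr_ge0 ?fine_ge0 ?mixture_ge0.
have intE B : measurable B ->
    (\int[mu]_(v in B) (eta y v * (fine (P E) * mixture v))%:E =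
     \int[mu]_(v in B) (fine (P E) * (p y * f y v))%:E)%E.
  move=> mB; rewrite -(@integral_density _ _ _ _ _ P _ E U)//; last first.
    exact: measure_mixture.
  by rewrite -etaE// measure_class.
have : ae_eq mu setT (fun v => (eta y v * (fine (P E) * mixture v))%:E)
    (fun v => (fine (P E) * (p y * f y v))%:E).
  apply: integral_ae_eq => //.
  (* The integral is the probability of an event, hence finite. *)
  - apply/integrableP; split.
      by apply/measurable_EFinP; exact: measurable_funM.
    under eq_integral
      do rewrite gee0_abs ?lee_fin ?mulr_ge0 ?mixture_ge0 ?fine_ge0//.
    rewrite intE// -measure_class// ltey_eq fin_num_measure//.
    apply: measurableI => //; apply: measurableI => //.
    exact: measurable_preimageT.
  - apply/measurable_EFinP; apply: measurable_funM => //.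
    exact: measurable_funM.
  - by move=> B _ mB; exact: intE.
apply: filterS => v /(_ Logic.I)[]; rewrite mulrCA.
exact: mulfI.
Qed.

(** An everywhere defined version of the posterior, equal to 0 where the mixture density
    vanishes. *)
Definition bayes_ratio y v := p y * f y v / mixture v.

Lemma measurable_bayes_ratio y : measurable_fun setT (bayes_ratio y).
Proof.
(* On nonnegative reals, 0 included, the inverse is the power -1, which is measurable. *)
rewrite (_ : bayes_ratio y = fun v => p y * f y v * (mixture v `^ (-1))).
  apply: measurable_funM.
    by apply: measurable_funM => //; case: (fE y).
  apply: (measurableT_comp (measurable_powR (-1))).
  exact: measurable_mixture.
by apply/funext => v; rewrite powR_inv1// mixture_ge0.
Qed.

Lemma bayes_ratio_itv y v : 0 <= bayes_ratio y v <= 1.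
Proof.
have m0 := mixture_ge0 v.
rewrite /bayes_ratio divr_ge0 ?mulr_ge0//=.
have [->|mN0] := eqVneq (mixture v) 0; first by rewrite invr0 mulr0.
rewrite ler_pdivrMr ?lt_neqAle 1?eq_sym ?mN0// mul1r.
by rewrite /mixture (bigD1 y)//= lerDl sumr_ge0// => c _; rewrite mulr_ge0.
Qed.

(** Passes from [mu] to the law of [U] on [E]. The zeros of the mixture may have positive [mu]
    measure but carry no probability, so they can join the exceptional set. *)
Lemma ae_mixture (Q : T -> Prop) : {ae mu, forall v, Q v} ->
  exists N, [/\ measurable N, P (E `&` U @^-1` N) = 0%E &
    forall v, ~ N v -> mixture v != 0 /\ Q v].
Proof.
move=> [N [mN N0 QN]].
have m0 : measurable [set v | mixture v = 0].
  have -> : [set v | mixture v = 0] = mixture @^-1` [set 0] by [].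
  rewrite -[X in measurable X]setTI.
  by apply: measurable_mixture => //; exact: measurable_set1.
exists (N `|` [set v | mixture v = 0]); split.
- exact: measurableU.
- rewrite preimage_setU setIUr null_set_setU//.
  + by apply: measurableI => //; exact: (measurable_preimageT mU).
  + by apply: measurableI => //; exact: (measurable_preimageT mU).
  + exact: measure_mixture_null.
  + exact: measure_mixture_eq0.
- move=> v /not_orP[nN m0v]; split; first exact/eqP.
  by apply: contrapT => nQ; apply: nN; exact: QN.
Qed.

Lemma posterior_bayes_ratio (eta : 'I_C -> T -> R) (y : 'I_C) : P E != 0%E ->
  is_posterior P E U Y eta ->
  {ae P, forall s, E s -> eta y (U s) = bayes_ratio y (U s)}.
Proof.
move=> PE0 etaE; have := bayes y PE0 etaE.
move=> /ae_mixture[N [mN N0 NP]].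
exists (E `&` U @^-1` N); split => //.
  by apply: measurableI => //; exact: (measurable_preimageT mU).
move=> s /= /not_implyP[Es ne]; split => //.
apply: contrapT => /NP[m0 mE']; apply: ne.
by rewrite /bayes_ratio -mE' mulfK.
Qed.

End class_mixture.

(** A posterior given [Z] that almost surely depends on [G (Z s)] alone is a posterior given
    [G \o Z], since the events defined by [G \o Z] are among those defined by [Z]. *)
Lemma is_posterior_comp d1 d2 d3 (S : measurableType d1) (T : measurableType d2)
    (T' : measurableType d3) (R : realType) (P : probability S R) C (E : set S)
    (Z : S -> T) (Y : S -> 'I_C) (G : T -> T') eta (h : 'I_C -> T' -> R) :
  measurable E -> measurable_fun setT Z -> measurable_fun setT G ->
  (forall y, measurable_fun setT (h y)) ->
  (forall y v, 0 <= h y v <= 1) ->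
  (forall y, {ae P, forall s, E s -> eta y (Z s) = h y (G (Z s))}) ->
  is_posterior P E Z Y eta -> is_posterior P E (G \o Z) Y h.
Proof.
move=> mE mZ mG mh h01 etah etaE y; split => // B mB.
have mGB := measurable_preimageT mG mB.
have [meta eta01 etaP] := etaE y.
rewrite comp_preimage etaP//; apply: ge0_ae_eq_integral.
- by apply: measurableI => //; exact: measurable_preimageT.
- by apply: measurable_funTS; apply/measurable_EFinP; exact: measurableT_comp.
- apply: measurable_funTS; apply/measurable_EFinP; apply: measurableT_comp => //.
  exact: measurableT_comp.
- by move=> s _; rewrite lee_fin; case/andP: (eta01 (Z s)).
- by move=> s _; rewrite lee_fin; case/andP: (h01 y (G (Z s))).
- by apply: filterS (etah y) => s es [Es _] /=; rewrite es.
Qed.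

(** * Inversion of hyperspherical coordinates *)

Section polar_inverse.
Variables (R : realType) (n : nat).
Implicit Types z : n.-tuple R.

(** The factor 1 is for the last coordinate, a product of sines without a cosine. *)
Definition polar_inv (u : R * n.-1.-tuple R) : n.-tuple R :=
  [tuple u.1 * (\prod_(j < k) sin (nth 0 u.2 j)) *
         (if (k.+1 < n)%N then cos (nth 0 u.2 k) else 1) | k < n].

Lemma tail_norm_ge0 z k : 0 <= tail_norm z k. Proof. exact: sqrtr_ge0. Qed.

Lemma tail_normS z k : (k < n)%N ->
  tail_norm z k ^+ 2 = nth 0 z k ^+ 2 + tail_norm z k.+1 ^+ 2.
Proof.
move=> kn; rewrite !sqr_sqrtr ?sumr_ge0// => [|i _|i _]; rewrite ?sqr_ge0//.
rewrite (bigD1 (Ordinal kn))//= (tnth_nth 0); congr (_ + _).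
by apply: eq_bigl => i; rewrite -val_eqE/= [in RHS]ltn_neqAle eq_sym andbC.
Qed.

Lemma tail_norm_eq0 z k : (k < n)%N -> tail_norm z k = 0 ->
  nth 0 z k = 0 /\ tail_norm z k.+1 = 0.
Proof.
move=> kn t0; have /eqP := tail_normS z kn; rewrite t0 expr0n/= eq_sym.
by rewrite paddr_eq0 ?sqr_ge0// !sqrf_eq0 => /andP[/eqP ? /eqP].
Qed.

Lemma nth_tail_norm_itv z k : (k < n)%N ->
  -1 <= nth 0 z k / tail_norm z k <= 1.
Proof.
move=> kn; rewrite -ler_norml normrM normfV (ger0_norm (tail_norm_ge0 _ _)).
have [->|t0] := eqVneq (tail_norm z k) 0; first by rewrite invr0 mulr0.
rewrite ler_pdivrMr ?lt_neqAle ?tail_norm_ge0 1?eq_sym ?t0// mul1r.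
rewrite -(ler_pXn2r (n := 2))// ?nnegrE ?tail_norm_ge0// tail_normS//.
by rewrite real_normK ?num_real// lerDl sqr_ge0.
Qed.

(** This is [sin (acos x) = sqrt (1 - x ^ 2)] combined with Pythagoras in [tail_normS]; a zero tail
    makes both sides 0. *)
Lemma tail_norm_sin_acos z k : (k < n)%N ->
  tail_norm z k * sin (acos (nth 0 z k / tail_norm z k)) = tail_norm z k.+1.
Proof.
move=> kn; rewrite sin_acos ?nth_tail_norm_itv//.
have [t0|t0] := eqVneq (tail_norm z k) 0.
  by have [_ ->] := tail_norm_eq0 kn t0; rewrite t0 mul0r.
rewrite -[RHS](ger0_norm (tail_norm_ge0 _ _)) -sqrtr_sqr.
rewrite -[X in X * _](ger0_norm (tail_norm_ge0 _ _)) -sqrtr_sqr.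
rewrite -sqrtrM ?sqr_ge0//; congr Num.sqrt.
rewrite mulrBr mulr1 -exprMn mulrCA divff// mulr1 tail_normS//.
by rewrite addrAC subrr add0r.
Qed.

Lemma cos_2piB (a : R) : cos (2 * pi - a) = cos a.
Proof. by rewrite cosB mulr_natl cos2pi sin2pi mul1r mul0r addr0. Qed.

Lemma sin_2piB (a : R) : sin (2 * pi - a) = - sin a.
Proof. by rewrite sinB mulr_natl cos2pi sin2pi mul1r mul0r sub0r. Qed.

Lemma tail_norm_cos z k : (k < n)%N ->
  tail_norm z k * cos (polar_angle z k) = nth 0 z k.
Proof.
move=> kn.
have -> : cos (polar_angle z k) = nth 0 z k / tail_norm z k.
  rewrite /polar_angle; case: ifP => _; rewrite ?cos_2piB acosK//;
    by rewrite in_itv/= nth_tail_norm_itv.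
have [t0|t0] := eqVneq (tail_norm z k) 0; last by rewrite mulrCA divff// mulr1.
by have [-> _] := tail_norm_eq0 kn t0; rewrite t0 mul0r.
Qed.

(** For the last angle the remaining tail is a single coordinate, and the reflection to [2 * pi - a]
    restores its sign. *)
Lemma tail_norm_sin z k : (k.+1 < n)%N ->
  tail_norm z k * sin (polar_angle z k) =
    if k.+2 == n then nth 0 z k.+1 else tail_norm z k.+1.
Proof.
move=> kn; have kn' := ltnW kn; rewrite /polar_angle.
have [k2n|_]/= := eqVneq k.+2 n; last exact: tail_norm_sin_acos.
have tE : tail_norm z k.+1 = `|nth 0 z k.+1|.
  rewrite -[LHS]ger0_norm ?tail_norm_ge0// -!sqrtr_sqr tail_normS//.
  rewrite [X in _ + X ^+ 2](_ : _ = 0) ?expr0n ?addr0//.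
  rewrite /tail_norm big_pred0 ?sqrtr0// => i.
  by rewrite k2n leqNgt ltn_ord.
case: ltP => z0.
  by rewrite sin_2piB mulrN tail_norm_sin_acos// tE ltr0_norm// opprK.
by rewrite tail_norm_sin_acos// tE ger0_norm.
Qed.

(** Each sine shortens the tail by one coordinate. The bound on [k] keeps the last, signed sine out
    of the product. *)
Lemma l2norm_prod_sin z k : (k.+1 < n)%N ->
  l2norm z * \prod_(j < k) sin (polar_angle z j) = tail_norm z k.
Proof.
elim: k => [_|k ih kn]; first by rewrite big_ord0 mulr1.
by rewrite big_ord_recr/= mulrA ih 1?ltnW// tail_norm_sin 1?ltnW// (ltn_eqF kn).
Qed.

Lemma polar_coordsK : (1 < n)%N ->
  cancel (@polar_coords R n) polar_inv.
Proof.
move=> n1; have nE : n.-2.+2 = n by case: n n1 => [|[|]].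
move=> z; apply: eq_from_tnth => k; rewrite tnth_mktuple/=.
have angleE j : (j < n.-1)%N -> nth 0 (polar_angles z) j = polar_angle z j.
  by move=> jn; rewrite (nth_map (Ordinal jn)) ?size_enum_ord ?nth_enum_ord.
have prodE : \prod_(j < k) sin (nth 0 (polar_angles z) j) =
    \prod_(j < k) sin (polar_angle z j).
  apply: eq_bigr => j _; rewrite angleE//; apply: (leq_trans (ltn_ord j)).
  by rewrite -ltnS (ltn_predK n1).
rewrite prodE (tnth_nth 0); case: ifPn => kn.
  by rewrite angleE ?l2norm_prod_sin ?tail_norm_cos// -ltnS (ltn_predK n1).
have kE : (k : nat) = n.-2.+1.
  by apply: succn_inj; rewrite nE; apply/eqP; rewrite eqn_leq ltn_ord leqNgt.
(* Peels the last sine off the product; it turns the tail norm into the signed last coordinate. *)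
rewrite mulr1 kE big_ord_recr/= mulrA l2norm_prod_sin ?tail_norm_sin ?nE//.
by rewrite eqxx.
Qed.

End polar_inverse.

(** * Measurability of polar coordinates and of their inverse *)

Section measurable_polar.
Variables (R : realType).

Lemma measurable_nth n k : measurable_fun setT (fun z : n.-tuple R => nth 0 z k).
Proof.
have [kn|nk] := ltnP k n.
  rewrite (_ : (fun _ => _) = @tnth n R ^~ (Ordinal kn)).
    exact: measurable_tnth.
  by apply/funext => z; rewrite (tnth_nth 0).
rewrite (_ : (fun _ => _) = cst 0); first exact: measurable_cst.
by apply/funext => z; rewrite nth_default// size_tuple.
Qed.

Lemma measurable_tail_norm n k :
  measurable_fun setT (fun z : n.-tuple R => tail_norm z k).
Proof.
apply: measurableT_comp.
  exact: (continuous_measurable_fun (@sqrt_continuous R)).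
under eq_fun do rewrite big_mkcond/=.
apply: measurable_sum => i; case: (k <= i)%N; last exact: measurable_cst.
by apply: measurable_funX; exact: measurable_tnth.
Qed.

(** Truncation to the interval from -1 to 1 makes [acos] monotone on the whole line, hence
    measurable; the quotients that define the angles already lie in this interval. *)
Let clamp (x : R) := Num.max (-1) (Num.min x 1).

Let clamp_itv x : -1 <= clamp x <= 1.
Proof. by rewrite /clamp le_max lexx/= ge_max ge_min lexx orbT andbT; lra. Qed.

Let clamp_id x : -1 <= x <= 1 -> clamp x = x.
Proof. by move=> /andP[x0 x1]; rewrite /clamp (min_idPl x1) (max_idPr x0). Qed.

Let measurable_acos_clamp : measurable_fun setT (@acos R \o clamp).
Proof.
apply: nonincreasing_measurable => // x y xy /=.
rewrite leNgt -ltr_cos ?in_itv/= ?acos_ge0 ?acos_lepi ?clamp_itv//.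
rewrite !acosK ?in_itv/= ?clamp_itv// -leNgt /clamp.
by rewrite ge_max !le_max lexx/= le_min !ge_min xy lexx !orbT.
Qed.

Lemma measurable_polar_angle n k : (k < n)%N ->
  measurable_fun setT (fun z : n.-tuple R => polar_angle z k).
Proof.
move=> kn.
have mangle : measurable_fun setT
    (fun z : n.-tuple R => acos (nth 0 z k / tail_norm z k)).
  rewrite (_ : (fun _ => _) = (@acos R \o clamp) \o
      (fun z : n.-tuple R => nth 0 z k * (tail_norm z k `^ (-1)))); last first.
    apply/funext => z /=; rewrite powR_inv1 ?sqrtr_ge0// clamp_id//.
    exact: nth_tail_norm_itv.
  apply: measurableT_comp => //; apply: measurable_funM.
    exact: measurable_nth.
  apply: (measurableT_comp (measurable_powR (-1))).
  exact: measurable_tail_norm.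
rewrite /polar_angle; case: (k.+2 == n) => //=.
apply: measurable_fun_ifT => //.
  by apply: measurable_fun_ltr; [exact: measurable_nth|exact: measurable_cst].
by apply: measurable_funB => //; exact: measurable_cst.
Qed.

Lemma measurable_polar_coords n : measurable_fun setT (@polar_coords R n).
Proof.
apply: measurable_fun_pair; first exact: measurable_l2norm.
apply/measurable_fun_tnthP => i.
rewrite (_ : _ \o _ = fun z => polar_angle z i); last first.
  by apply/funext => z /=; rewrite tnth_mktuple.
by apply: measurable_polar_angle; rewrite (leq_trans (ltn_ord i))// leq_pred.
Qed.

Lemma measurable_polar_inv n : measurable_fun setT (@polar_inv R n).
Proof.
have mnth k : measurable_fun setT (fun u : R * n.-1.-tuple R => nth 0 u.2 k).
  rewrite (_ : (fun _ => _) = (fun t : n.-1.-tuple R => nth 0 t k) \o snd)//.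
  by apply: measurableT_comp; [exact: measurable_nth|exact: measurable_snd].
apply/measurable_fun_tnthP => i.
rewrite (_ : _ \o _ = fun u : R * n.-1.-tuple R =>
    u.1 * (\prod_(j < i) sin (nth 0 u.2 j)) *
    (if (i.+1 < n)%N then cos (nth 0 u.2 i) else 1)); last first.
  by apply/funext => u /=; rewrite tnth_mktuple.
apply: measurable_funM; last first.
  case: (i.+1 < n)%N => //; apply: measurableT_comp => //.
  exact: (continuous_measurable_fun (@continuous_cos R)).
apply: measurable_funM => //; apply: measurable_prod => j _.
apply: measurableT_comp => //.
exact: (continuous_measurable_fun (@continuous_sin R)).
Qed.

End measurable_polar.

(** * Lebesgue measure on the line, vMF constants, null sets of products *)

Section lebesgue_real.
Variable R : realType.

(* lebesgue_measure is a measure on measurableTypeR R, whose display differs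
   from that of R itself; this is the same function, as a measure on R. *)
Definition lebesgue_real : set R -> \bar R := @lebesgue_measure R.

Let lebesgue_real0 : lebesgue_real set0 = 0%E. Proof. exact: measure0. Qed.

Let lebesgue_real_ge0 A : (0 <= lebesgue_real A)%E.
Proof. exact: measure_ge0. Qed.

Let lebesgue_real_sigma_additive : semi_sigma_additive lebesgue_real.
Proof. exact: (@measure_semi_sigma_additive _ _ _ (@lebesgue_measure R)). Qed.

HB.instance Definition _ := isMeasure.Build _ _ _ lebesgue_real
  lebesgue_real0 lebesgue_real_ge0 lebesgue_real_sigma_additive.

End lebesgue_real.

(** Isolates the normalizing constant, which is the same for all mean directions and will cancel. *)
Lemma vmf_density_scale (R : realType) n (kappa : R) :
  exists K, forall w s : n.-tuple R,
    vmf_density kappa w s = K * expR (kappa * dotp w s).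
Proof. by eexists => w s; reflexivity. Qed.

(** Carries angular invariance, a statement on angles, to pairs of a norm and angles; a null strip
    stays null because infinity times 0 is 0. *)
Lemma ae_product_snd d1 d2 (T1 : measurableType d1) (T2 : measurableType d2)
    (R : realType) (m1 : {measure set T1 -> \bar R})
    (m2 : {sigma_finite_measure set T2 -> \bar R}) (Q : T2 -> Prop) :
  {ae m2, forall v, Q v} -> {ae (m1 \x m2)%E, forall u, Q u.2}.
Proof.
move=> [N [mN N0 QN]]; exists (setT `*` N); split.
- exact: measurableX.
- by rewrite product_measure1E// N0 mule0.
- by move=> u /= nQ; split => //; exact: QN.
Qed.

(** * The target posterior *)

Theorem theorem2
  (R : realType) (n C N : nat) (hn : (1 < n)%N)
  (dX dS dT : measure_display)
  (TX : measurableType dX) (feat : {mfun TX >-> n.-tuple R})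
  (* pooled source space: input, label, domain index *)
  (S : measurableType dS) (P : probability S R)
  (X : {RV P >-> TX}) (Y : S -> 'I_C) (D : S -> 'I_N)
  (mY : forall y, measurable (Y @^-1` [set y]))
  (mD : forall d, measurable (D @^-1` [set d]))
  (* target space *)
  (T : measurableType dT) (Pt : probability T R)
  (Xt : {RV Pt >-> TX}) (Yt : T -> 'I_C)
  (mYt : forall y, measurable (Yt @^-1` [set y])) :
  let src d := D @^-1` [set d] in
  let cls y := Y @^-1` [set y] in
  let clst y := Yt @^-1` [set y] in
  let Z s := feat (X s) in
  let Zt t := feat (Xt t) in
  let Zstar s := l2normalize (Z s) in
  let lebR := @lebesgue_measure R in
  let lebZ := lebesgue_tuple R n in
  let lebPhi := lebesgue_tuple R n.-1 in
  let prior := class_prob P Y in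
  forall
  (* conditioning events have positive probability *)
  (src_gt0 : forall d, (0 < P (src d))%E)
  (prior_gt0 : forall y, 0 < prior y)
  (* class probabilities do not depend on the domain *)
  (prior_src : forall d y, cprob P (src d) (cls y) = prior y)
  (prior_tgt : forall y, class_prob Pt Yt y = prior y)
  (* the domains are pairwise different *)
  (src_neq : forall d d', d != d' ->
    ~ (forall A y, measurable A ->
         joint_law P X Y (src d) A y = joint_law P X Y (src d') A y))
  (src_neq_tgt : forall d,
    ~ (forall A y, measurable A ->
         joint_law P X Y (src d) A y = joint_law Pt Xt Yt setT A y))
  (* continuous marginals on the input space *)
  (X_cont : forall d x, measurable [set x] ->
    cprob P (src d) (X @^-1` [set x]) = 0)
  (Xt_cont : forall x, measurable [set x] -> Pt (Xt @^-1` [set x]) = 0%E)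
  (* class-conditional densities of the latent representation *)
  (pZ : 'I_N -> 'I_C -> n.-tuple R -> R) (pZt : 'I_C -> n.-tuple R -> R)
  (pZE : forall d y, is_density P (src d `&` cls y) Z lebZ (pZ d y))
  (pZtE : forall y, is_density Pt (clst y) Zt lebZ (pZt y))
  (* conditional densities of the angles, and of the norm given the angles *)
  (pPhi : 'I_N -> 'I_C -> n.-1.-tuple R -> R) (pPhit : 'I_C -> n.-1.-tuple R -> R)
  (pPhiE : forall d y,
    is_density P (src d `&` cls y) (fun s => (polar_coords (Z s)).2)
      lebPhi (pPhi d y))
  (pPhitE : forall y,
    is_density Pt (clst y) (fun t => (polar_coords (Zt t)).2) lebPhi (pPhit y))
  (pR : 'I_N -> 'I_C -> R -> n.-1.-tuple R -> R)
  (pRt : 'I_C -> R -> n.-1.-tuple R -> R)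
  (pRE : forall d y,
    is_cond_density P (src d `&` cls y) (fun s => (polar_coords (Z s)).1)
      (fun s => (polar_coords (Z s)).2) lebR lebPhi (pPhi d y) (pR d y))
  (pRtE : forall y,
    is_cond_density Pt (clst y) (fun t => (polar_coords (Zt t)).1)
      (fun t => (polar_coords (Zt t)).2) lebR lebPhi (pPhit y) (pRt y))
  (* posteriors p(y | z, D = d), p(y | z^* ), p^t(y | z) *)
  (post : 'I_N -> 'I_C -> n.-tuple R -> R)
  (postE : forall d, is_posterior P (src d) Z Y (post d))
  (postStar : 'I_C -> n.-tuple R -> R)
  (postStarE : is_posterior P setT Zstar Y postStar)
  (postt : 'I_C -> n.-tuple R -> R)
  (posttE : is_posterior Pt setT Zt Yt postt)
  (* (i) angular invariance *)
  (angular_invariance : forall d y,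
    {ae lebPhi, forall phi, pPhi d y phi = pPhit y phi})
  (* (ii) von Mises-Fisher mixture *)
  (kappa : R) (kappa_gt0 : 0 < kappa)
  (w : 'I_C -> n.-tuple R) (w_unit : forall y, l2norm (w y) = 1)
  (vmf_component : forall y,
    is_density P (cls y) Zstar (@sphere_measure R n) (vmf_density kappa (w y)))
  (vmf_mixture :
    is_density P setT Zstar (@sphere_measure R n)
      (fun s => \sum_(y < C) prior y * vmf_density kappa (w y) s))
  (vmf_posterior : forall d y,
    {ae P, forall s, src d s -> post d y (Z s) = postStar y (Zstar s)})
  (d : 'I_N) (y : 'I_C),
  let ratio z c :=
    norm_ratio (pRt c) (pR d c) (polar_coords z).1 (polar_coords z).2 in
  {ae pushforward Pt Zt, forall z,
    (* w(r | phi, d, c) is defined for every class c *)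
    (forall c, pR d c (polar_coords z).1 (polar_coords z).2 != 0) ->
    postt y z =
      (vmf_density kappa (w y) (l2normalize z) * ratio z y * prior y) /
      (\sum_(c < C)
         vmf_density kappa (w c) (l2normalize z) * ratio z c * prior c)
    /\
    (vmf_density kappa (w y) (l2normalize z) * ratio z y * prior y) /
      (\sum_(c < C)
         vmf_density kappa (w c) (l2normalize z) * ratio z c * prior c) =
      (expR (kappa * dotp (w y) (l2normalize z)) * ratio z y * prior y) /
      (\sum_(c < C)
         expR (kappa * dotp (w c) (l2normalize z)) * ratio z c * prior c)}.
Proof.
move=> src cls clst Z Zt Zstar lebR lebZ lebPhi prior.
move=> src_gt0 prior_gt0 prior_src prior_tgt _ _ _ _ _ _ _ _ pPhi pPhit _ _.
move=> pR pRt pRE pRtE post postE postStar postStarE postt posttE.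
move=> angular_invariance kappa _ w _ vmf_component _ vmf_posterior d y ratio.
have mZ : measurable_fun setT Z by apply: measurableT_comp => //.
have mZt : measurable_fun setT Zt by apply: measurableT_comp => //.
have mZstar : measurable_fun setT Zstar.
  by apply: measurableT_comp => //; exact: measurable_l2normalize.
have mpc := @measurable_polar_coords R n.
have mpi := @measurable_polar_inv R n.
pose V c v := vmf_density kappa (w c) v.
have [K VE] := vmf_density_scale n kappa.
have priorE c : cprob P setT (cls c) = prior c.
  by rewrite /cprob setIT probability_setT divr1.
have priortE c : cprob Pt setT (clst c) = prior c.
  by rewrite /cprob setIT probability_setT divr1 -prior_tgt.
have VdE c : is_density P (setT `&` cls c) Zstar (@sphere_measure R n) (V c).
  by rewrite setTI.
(* if K vanished the class laws of Z* would have total mass 0; so no property of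
   besselI is needed *)
have K_neq0 : K != 0.
  apply/eqP => K0; have [_ _ /(_ setT measurableT)] := vmf_component y.
  rewrite integral0_eq; last by move=> s _; rewrite VE K0 mul0r.
  rewrite /cprob preimage_setT setTI divff.
    by move=> [/eqP]; rewrite oner_eq0.
  by rewrite gt_eqF//; exact: prior_gt0.
pose h := bayes_ratio prior V.
have mh c : measurable_fun setT (h c).
  exact: measurable_bayes_ratio priorE VdE c.
have h01 c v : 0 <= h c v <= 1 by exact: bayes_ratio_itv priorE VdE c v.
have PT0 : P setT != 0%E by rewrite probability_setT.
have PtT0 : Pt setT != 0%E by rewrite probability_setT.
have postStar_h c :=
  posterior_bayes_ratio measurableT mY mZstar priorE VdE c PT0 postStarE.
pose lam := (@lebesgue_real R \x lebPhi)%E : {measure set _ -> \bar R}.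
(* [f] and [ft] are the joint class densities of (r, phi) in the source [d] and in the target. *)
pose f c u := pR d c u.1 u.2 * pPhi d c u.2.
pose ft c u := pRt c u.1 u.2 * pPhit c u.2.
have fE c : is_density P (src d `&` cls c) (polar_coords (n:=n) \o Z) lam (f c).
  have [_ _ kE] := pRE d c; exact: kE.
have ftE c :
    is_density Pt (setT `&` clst c) (polar_coords (n:=n) \o Zt) lam (ft c).
  rewrite setTI; have [_ _ kE] := pRtE c; exact: kE.
have mlz : measurable_fun setT (@l2normalize R n \o @polar_inv R n).
  by apply: measurableT_comp => //; exact: measurable_l2normalize.
have src_post : is_posterior P (src d) (polar_coords (n:=n) \o Z) Y
    (fun c => h c \o (@l2normalize R n \o @polar_inv R n)).
  apply: is_posterior_comp (postE d) => //; first exact: mD.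
  - by move=> c; exact: measurableT_comp.
  - by move=> c v; exact: h01.
  - move=> c; apply: filterS2 (vmf_posterior d c) (postStar_h c) => s e1 e2 sd /=.
    by rewrite polar_coordsK// e1// e2.
have mpostt c : measurable_fun setT (postt c) by case: (posttE c).
have postt01 c v : 0 <= postt c v <= 1 by case: (posttE c).
have tgt_post : is_posterior Pt setT (polar_coords (n:=n) \o Zt) Yt
    (fun c => postt c \o @polar_inv R n).
  apply: is_posterior_comp posttE => //.
  - by move=> c; exact: measurableT_comp.
  - by move=> c v; exact: postt01.
  - by move=> c; apply: aeW => s _ /=; rewrite polar_coordsK.
have Psrc0 : P (src d) != 0%E by rewrite gt_eqF.
have mU : measurable_fun setT (polar_coords (n:=n) \o Z).
  exact: measurableT_comp.
have mUt : measurable_fun setT (polar_coords (n:=n) \o Zt).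
  exact: measurableT_comp.
have src_bayes c := bayes (mD d) mY mU (prior_src d) fE c Psrc0 src_post.
have tgt_bayes := bayes measurableT mYt mUt priortE ftE y PtT0 tgt_post.
have ang c := ae_product_snd (@lebesgue_real R) (angular_invariance d c).
have good : {ae lam, forall u,
    [/\ forall c, h c (l2normalize (polar_inv u)) * mixture prior f u =
          prior c * f c u,
        postt y (polar_inv u) * mixture prior ft u = prior y * ft y u &
        forall c, pPhi d c u.2 = pPhit c u.2]}.
  apply: filterS3 (filter_forall _ src_bayes) tgt_bayes (filter_forall _ ang).
  by move=> u.
(* The exceptional set is taken null for the target law, so off it the target mixture is nonzero. *)
have [A [mA A0 AP]] := ae_mixture measurableT mYt mUt priortE ftE good.
exists (@polar_coords R n @^-1` A); split.
- exact: measurable_preimageT.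
- by move: A0; rewrite setTI.
move=> z /= nz; apply: contrapT => /AP[]; rewrite polar_coordsK//.
move=> qt0 [srcu tgtu angu]; apply: nz => pR0.
set u := polar_coords z in qt0 srcu tgtu angu pR0.
set s := l2normalize z in srcu *.
(* The factor that Bayes' rule for the source shares among all classes. *)
pose k := mixture prior f u / mixture prior V s.
have ftk c : prior c * ft c u = (V c s * ratio z c * prior c) * k.
  transitivity (ratio z c * (prior c * f c u)).
    (* The angular densities coincide, and [pR0] allows the denominator of the ratio to cancel. *)
    by rewrite /ft /f /ratio /norm_ratio -/u angu; field; exact: pR0.
  by rewrite -srcu /h /bayes_ratio /k; ring.
have qtE : mixture prior ft u = (\sum_(c < C) V c s * ratio z c * prior c) * k.
  by rewrite mulr_suml; apply: eq_bigr => c _; exact: ftk.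
split.
  (* The product of the two is the target mixture density, nonzero here; this also excludes a zero
     denominator in [k]. *)
  have /andP[S0 k0] : (\sum_(c < C) V c s * ratio z c * prior c != 0) && (k != 0).
    by rewrite -negb_or -mulf_eq0 -qtE.
  apply: (mulIf k0); apply: (mulIf S0).
  by rewrite -mulrA (mulrC k) -qtE tgtu ftk [RHS]mulrAC divfK.
(* Expands the right-hand fraction by [K / K]. *)
rewrite VE -[X in _ = X]mul1r -(divff K_neq0) mulf_div !mulrA; congr (_ / _).
by rewrite mulr_sumr; apply: eq_bigr => c _; rewrite VE !mulrA.
Qed.
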